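(* Let $f:\mathbb{R}^D\times\mathbb{R}^M\to\mathbb{R}$ be of the form $f(x;\boldsymbol\epsilon)=h(x)+\sum_{m=1}^M g_m(x)\,\epsilon_m$ for some functions $h,g_1,\dots,g_M:\mathbb{R}^D\to\mathbb{R}$. Let the noise vector $\boldsymbol\epsilon=[\epsilon_1,\dots,\epsilon_M]^{\mathrm T}$ consist of random variables that follow stable distributions with a common $\alpha\in(0,2]$, the distribution of the $m$-th element $\epsilon_m$ being $\mathbf{S}(\alpha,\beta_m,\gamma_m,\delta_m)$. Let $\boldsymbol\epsilon_{i,k}$ ($i=1,2$ and $k=1,\dots,K$) be i.i.d. copies of $\boldsymbol\epsilon$, and let $\Delta=[\delta_1,\dots,\delta_M]^{\mathrm T}$. With $\beta'',\gamma'',\delta''$ as defined in the context, let $$\epsilon^{\mathrm{AVE}}\sim \mathbf{S}\Big(\alpha,\ \beta''(x_1,x_2),\ 1,\ \Big(\tfrac{\delta''(x_1,x_2)}{\gamma''(x_1,x_2)}+\tfrac{2}{\pi}\beta''(x_1,x_2)\log(\gamma''(x_1,x_2))\Big)\cdot \mathbf{1}\{\alpha=1\}\Big).$$ Define $\eta_\Delta(x_1,x_2)=\mathrm{sign}(f(x_1;\Delta)-f(x_2;\Delta))$ and $\widehat\eta^{\mathrm{AVE}}_{\epsilon}(x_1,x_2)=\mathrm{sign}\big(\tfrac1K\sum_{k=1}^K f(x_1;\boldsymbol\epsilon_{1,k})-\tfrac1K\sum_{k=1}^K f(x_2;\boldsymbol\epsilon_{2,k})\big)$. For any pair $(x_1,x_2)$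 with $\eta_\Delta(x_1,x_2)\ne 0$, we have $$\Pr\big[\widehat\eta^{\mathrm{AVE}}_{\epsilon}(x_1,x_2)=\eta_\Delta(x_1,x_2)\big]=\Pr\Big[-\eta_\Delta(x_1,x_2)\cdot\epsilon^{\mathrm{AVE}}<\frac{K^{1-\frac1\alpha}\cdot|f(x_1;\Delta)-f(x_2;\Delta)|}{\gamma''(x_1,x_2)}\Big].$$ If $\eta_\Delta(x_1,x_2)=0$, then $\Pr\big[\widehat\eta^{\mathrm{AVE}}_{\epsilon}(x_1,x_2)=\eta_\Delta(x_1,x_2)\big]=0$.
   Context: $\mathrm{sign}(\cdot)\in\{-1,0,1\}$ is the sign function and $\mathbf{1}\{P\}$ is $1$ if $P$ is true and $0$ otherwise. Stable distribution: for $\alpha\in(0,2]$, $\beta\in[-1,1]$, $\gamma\in(0,\infty)$, $\delta\in\mathbb{R}$, $\mathbf{S}(\alpha,\beta,\gamma,\delta)$ is the distribution of a real random variable $X$ with characteristic function $$\mathbb{E}[e^{\mathrm{i}tX}]=\begin{cases}\exp\big(-\gamma^\alpha|t|^\alpha(1-\mathrm{i}\beta\tan(\tfrac{\pi\alpha}{2})\,\mathrm{sign}(t))+\mathrm{i}\delta t\big)&\alpha\neq1,\\ \exp\big(-\gamma|t|(1+\mathrm{i}\beta\tfrac2\pi\,\mathrm{sign}(t)\log|t|)+\mathrm{i}\delta t\big)&\alpha=1.\end{cases}$$ Notation: $$\gamma'(x)=\Big(\sum_{m=1}^M|\gamma_m g_m(x)|^\alpha\Big)^{1/\alpha},\qquad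 \beta'(x)=\frac{\sum_{m=1}^M\beta_m\,\mathrm{sign}(g_m(x))\,|g_m(x)\gamma_m|^\alpha}{\gamma'(x)^\alpha},$$ $$\delta'(x)=-\frac2\pi\sum_{m=1}^M\beta_m\gamma_m g_m(x)\log|g_m(x)|,$$ $$\beta''(x_1,x_2)=\frac{\beta'(x_1)\gamma'(x_1)^\alpha-\beta'(x_2)\gamma'(x_2)^\alpha}{\gamma'(x_1)^\alpha+\gamma'(x_2)^\alpha},\quad \gamma''(x_1,x_2)=(\gamma'(x_1)^\alpha+\gamma'(x_2)^\alpha)^{1/\alpha},\quad \delta''(x_1,x_2)=\delta'(x_1)-\delta'(x_2).$$
   Formalization: The location of ε^AVE has log(Kγ'') in place of log(γ''), since the printed one fails for α=1, K≥2, β''≠0; the components of ε are assumed mutually independent (the claim fails otherwise); γ''(x1,x2)≠0 and K≥1 are assumed. *)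

(* Defs.v *)
From HB Require Import structures.
From mathcomp Require Import all_boot all_order all_algebra.
From mathcomp Require Import complex.
From mathcomp Require Import all_classical all_reals all_analysis.

Set Implicit Arguments.
Unset Strict Implicit.
Unset Printing Implicit Defensive.

Import Order.TTheory GRing.Theory Num.Theory.
Import numFieldNormedType.Exports.

Local Open Scope classical_set_scope.
Local Open Scope ring_scope.
Local Open Scope complex_scope.

(* e^(a + ib) = e^a (cos b + i sin b) *)
Definition cexp (R : realType) (z : R[i]) : R[i] :=
  (expR (complex.Re z))%:C * (cos (complex.Im z) +i* sin (complex.Im z)).

(* t |-> E[e^(itX)]; cos and sin are bounded, so both expectations are finite
   as soon as X is measurable. *)
Definition char_fun (d : measure_display) (T : measurableType d) (R : realType)
    (P : probability T R) (X : T -> R) (t : R) : R[i] :=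
  fine 'E_P[fun w => cos (t * X w)] +i* fine 'E_P[fun w => sin (t * X w)].

(* In the branch a = 1, t = 0 is harmless: the factor `|t| vanishes
   (and ln 0 = 0). *)
Definition stable_char_fun (R : realType) (a b c l : R) (t : R) : R[i] :=
  if a != 1 then
    cexp (- (c `^ a * `|t| `^ a)%:C
            * (1 - 'i * (b * tan (pi * a / 2) * Num.sg t)%:C)
          + 'i * (l * t)%:C)
  else
    cexp (- (c * `|t|)%:C
            * (1 + 'i * (b * (2 / pi) * Num.sg t * ln `|t|)%:C)
          + 'i * (l * t)%:C).

(* X ~ S(a, b, c, l), meaningful for 0 < a <= 2, -1 <= b <= 1 and 0 < c *)
Definition has_stable_law (d : measure_display) (T : measurableType d)
    (R : realType) (P : probability T R) (X : T -> R) (a b c l : R) : Prop :=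
  forall t : R, char_fun P X t = stable_char_fun a b c l t.

Definition mutually_independent (d d' : measure_display)
    (T : measurableType d) (T' : measurableType d') (R : realType)
    (P : probability T R) (I : finType) (X : I -> T -> T') : Prop :=
  forall (J : {set I}) (A : I -> set T'), (forall i, measurable (A i)) ->
    P (\bigcap_(i in [set` J]) (X i @^-1` A i)) =
    (\prod_(i in J) P (X i @^-1` A i))%E.

(* The parameters transferred from the noise to f(x; eps).  Totalized operations
   agree with the usual conventions: gamma' x = 0 iff all the gamma_m g_m(x)
   vanish, and then beta' x * gamma' x `^ alpha = 0; a term of delta' x with
   g_m(x) = 0 is 0. *)
Section parameters.
Context {R : realType} {D M : nat}.
Implicit Types (alpha : R) (beta gamma : 'I_M -> R)
  (g : 'I_M -> 'rV[R]_D -> R) (x : 'rV[R]_D).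

Definition gamma' alpha gamma g x : R :=
  (\sum_(m < M) `|gamma m * g m x| `^ alpha) `^ (1 / alpha).

Definition beta' alpha beta gamma g x : R :=
  (\sum_(m < M) beta m * Num.sg (g m x) * `|g m x * gamma m| `^ alpha)
  / gamma' alpha gamma g x `^ alpha.

Definition delta' beta gamma g x : R :=
  - (2 / pi) * \sum_(m < M) beta m * gamma m * g m x * ln `|g m x|.

Definition beta'' alpha beta gamma g x1 x2 : R :=
  (beta' alpha beta gamma g x1 * gamma' alpha gamma g x1 `^ alpha
   - beta' alpha beta gamma g x2 * gamma' alpha gamma g x2 `^ alpha)
  / (gamma' alpha gamma g x1 `^ alpha + gamma' alpha gamma g x2 `^ alpha).

Definition gamma'' alpha gamma g x1 x2 : R :=
  (gamma' alpha gamma g x1 `^ alpha + gamma' alpha gamma g x2 `^ alpha)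
    `^ (1 / alpha).

Definition delta'' beta gamma g x1 x2 : R :=
  delta' beta gamma g x1 - delta' beta gamma g x2.

(* The location of the standardized averaged difference.  For alpha = 1,
   averaging K i.i.d. copies of S(1, b, c, l) yields
   S(1, b, c, l + 2 / pi * b * c * log K), hence the K inside the logarithm;
   it has no effect when K = 1 or beta'' = 0. *)
Definition delta_ave alpha beta gamma g (K : nat) x1 x2 : R :=
  (delta'' beta gamma g x1 x2 / gamma'' alpha gamma g x1 x2
   + 2 / pi * beta'' alpha beta gamma g x1 x2
     * ln (K%:R * gamma'' alpha gamma g x1 x2))
  * (alpha == 1)%:R.

End parameters.

Section estimators.
Context {R : realType} {D M : nat}.
Implicit Types (f : 'rV[R]_D -> M.-tuple R -> R) (x : 'rV[R]_D).

Definition eta_true f (Delta : M.-tuple R) x1 x2 : R :=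
  Num.sg (f x1 Delta - f x2 Delta).

(* e1 k and e2 k are the noise vectors of the k-th evaluations at x1 and x2 *)
Definition eta_ave f (K : nat) (e1 e2 : 'I_K -> M.-tuple R) x1 x2 : R :=
  Num.sg (1 / K%:R * (\sum_(k < K) f x1 (e1 k))
          - 1 / K%:R * (\sum_(k < K) f x2 (e2 k))).

End estimators.

(* Main.v *)
Require Import Defs.
From HB Require Import structures.
From mathcomp Require Import all_boot all_order all_algebra.
From mathcomp Require Import complex.
From mathcomp Require Import all_classical all_reals all_analysis measurable_realfun.
From mathcomp Require Import ring lra.

Import Order.TTheory GRing.Theory Num.Theory.
Import numFieldNormedType.Exports.

Local Open Scope classical_set_scope.
Local Open Scope ring_scope.

(** The characteristic function of a sum of independent variables is the product
    of the characteristic functions, so the averaged difference is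
    [f x1 Delta - f x2 Delta] plus a positive multiple of a variable [Y] with the
    characteristic function of [eAVE].  It remains to see that a characteristic
    function determines [P (Y < a)].  Equal characteristic functions give equal
    expectations of trigonometric polynomials; with [u = 1 + sin ((x - a) / N)],
    the trigonometric polynomials [(1 - (u ^ 2 / 4) ^ n) ^ (n * 4 ^ n)] converge
    boundedly to the indicator of [sin ((x - a) / N) < 0] as [n] grows, and the
    latter converges to the indicator of [x < a] as [N] grows.  Ties have
    probability [0] because the characteristic function of [Y] vanishes at
    infinity. *)

(** * Bounded measurable functions *)

Section bounded_measurable.
Context {d : measure_display} {T : measurableType d} {R : realType}.
Implicit Types F G : T -> R.

Definition bounded_measurable F :=
  measurable_fun [set: T] F /\ exists c, forall x, `|F x| <= c.

Lemma bounded_measurable_cst c : bounded_measurable (fun=> c).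
Proof. by split; [exact: measurable_cst|exists `|c|]. Qed.

Lemma bounded_measurableD F G : bounded_measurable F -> bounded_measurable G ->
  bounded_measurable (fun x => F x + G x).
Proof.
move=> [mF [a Fa]] [mG [b Gb]]; split; first exact: measurable_funD.
by exists (a + b) => x; rewrite (le_trans (ler_normD _ _))// lerD.
Qed.

Lemma bounded_measurableM F G : bounded_measurable F -> bounded_measurable G ->
  bounded_measurable (fun x => F x * G x).
Proof.
move=> [mF [a Fa]] [mG [b Gb]]; split; first exact: measurable_funM.
by exists (a * b) => x; rewrite normrM ler_pM.
Qed.

Lemma bounded_measurableB F G : bounded_measurable F -> bounded_measurable G ->
  bounded_measurable (fun x => F x - G x).
Proof.
move=> [mF [a Fa]] [mG [b Gb]]; split; first exact: measurable_funB.
by exists (a + b) => x; rewrite (le_trans (ler_normB _ _))// lerD.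
Qed.

Lemma bounded_measurable_indic A : measurable A -> bounded_measurable (\1_A : T -> R).
Proof.
move=> mA; split; first exact: measurable_indic.
by exists 1 => x; rewrite indicE; case: (_ \in _); rewrite ?normr1 ?normr0.
Qed.

Lemma bounded_measurable_sum (I : Type) (s : seq I) (F : I -> T -> R) :
  (forall i, bounded_measurable (F i)) ->
  bounded_measurable (fun x => \sum_(i <- s) F i x).
Proof.
move=> bF; elim: s => [|i s IH].
  by under eq_fun do rewrite big_nil; exact: bounded_measurable_cst.
by under eq_fun do rewrite big_cons; exact: bounded_measurableD.
Qed.

End bounded_measurable.

Lemma bounded_measurable_comp {d d' : measure_display} {T : measurableType d}
    {T' : measurableType d'} {R : realType} (f : T' -> R) (X : T -> T') :
  bounded_measurable f -> measurable_fun setT X ->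
  bounded_measurable (fun x => f (X x)).
Proof.
move=> [mf [c fc]] mX; split; first exact: measurableT_comp.
by exists c => x.
Qed.

Lemma bounded_measurable_cos {R : realType} (t : R) :
  bounded_measurable (fun x : R => cos (t * x)).
Proof.
split; last by exists 1 => x; rewrite ler_norml cos_geN1 cos_le1.
apply: continuous_measurable_fun => x.
apply: continuous_comp; [exact: mulrl_continuous|exact: continuous_cos].
Qed.

Lemma bounded_measurable_sin {R : realType} (t : R) :
  bounded_measurable (fun x : R => sin (t * x)).
Proof.
split; last by exists 1 => x; rewrite ler_norml sin_geN1 sin_le1.
apply: continuous_measurable_fun => x.
apply: continuous_comp; [exact: mulrl_continuous|exact: continuous_sin].
Qed.

(** * Expectations of bounded measurable functions *)

Section bounded_expectation.
Context {d : measure_display} {T : measurableType d} {R : realType}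
  (P : probability T R).
Implicit Types F G : T -> R.

Lemma bounded_measurable_integrable F :
  bounded_measurable F -> P.-integrable setT (EFin \o F).
Proof.
move=> [mF [c Fc]]; apply: measurable_bounded_integrable => //.
  by rewrite [X in (X < _)%E]probability_setT ltry.
by exists c; split; [exact: num_real|move=> x cx y _; exact: le_trans (Fc y) (ltW cx)].
Qed.

Lemma Rintegral_indic A : measurable A -> \int[P]_x (\1_A x : R) = fine (P A).
Proof. by move=> mA; rewrite /Rintegral integral_indic// setIT. Qed.

Lemma expect_cst (c : R) : \int[P]_x c = c.
Proof. by rewrite Rintegral_cst// [X in fine X]probability_setT mulr1. Qed.

Lemma expectD F G : bounded_measurable F -> bounded_measurable G ->
  \int[P]_x (F x + G x) = \int[P]_x F x + \int[P]_x G x.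
Proof. by move=> bF bG; rewrite RintegralD//; exact: bounded_measurable_integrable. Qed.

Lemma expectB F G : bounded_measurable F -> bounded_measurable G ->
  \int[P]_x (F x - G x) = \int[P]_x F x - \int[P]_x G x.
Proof. by move=> bF bG; rewrite RintegralB//; exact: bounded_measurable_integrable. Qed.

Lemma expectZ F c : bounded_measurable F ->
  \int[P]_x (c * F x) = c * \int[P]_x F x.
Proof. by move=> bF; rewrite RintegralZl//; exact: bounded_measurable_integrable. Qed.

Lemma expect_sum (I : Type) (s : seq I) (F : I -> T -> R) :
  (forall i, bounded_measurable (F i)) ->
  \int[P]_x (\sum_(i <- s) F i x) = \sum_(i <- s) \int[P]_x F i x.
Proof.
move=> bF; elim: s => [|i s IH].
  by under eq_Rintegral do rewrite big_nil; rewrite expect_cst big_nil.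
under eq_Rintegral do rewrite big_cons; rewrite expectD//.
  by rewrite IH big_cons.
exact: bounded_measurable_sum.
Qed.

Lemma le_expect F G : bounded_measurable F -> bounded_measurable G ->
  (forall x, F x <= G x) -> \int[P]_x F x <= \int[P]_x G x.
Proof.
by move=> bF bG FG; apply: le_Rintegral => //; exact: bounded_measurable_integrable.
Qed.

(** Dominated convergence with the constant [c] as dominating function, which is integrable because
    [P] is finite; the bound [c] passes to the limit [F]. *)
Lemma bounded_convergence (f : nat -> T -> R) F c :
  (forall n, measurable_fun setT (f n)) -> (forall n x, `|f n x| <= c) ->
  (forall x, f n x @[n --> \oo] --> F x) ->
  bounded_measurable F /\ \int[P]_x f n x @[n --> \oo] --> \int[P]_x F x.
Proof.
move=> mf fc fF.
have mF : measurable_fun setT F.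
  by apply: (measurable_fun_cvg mf) => x _; exact: fF.
have bF : bounded_measurable F.
  split=> //; exists c => x.
  have : `|f n x| @[n --> \oo] --> `|F x| by apply: cvg_norm.
  by move=> h; apply: (ler_cvg_to h (cvg_cst c)); exact: nearW.
split=> //.
have mE (h : T -> R) :
    measurable_fun setT h -> measurable_fun setT (fun x => (h x)%:E).
  by move=> mh; exact/measurable_EFinP.
have cvE x : (f n x)%:E @[n --> \oo] --> (F x)%:E.
  by apply: cvg_EFin; [exact: nearW|exact: fF].
have [_ _] := @dominated_convergence _ _ _ P setT measurableT
  (fun n x => (f n x)%:E) (fun x => (F x)%:E) (fun=> c%:E)
  (fun n => mE _ (mf n))
  (mE _ mF)
  (aeW _ (fun x _ => cvE x))
  (bounded_measurable_integrable _ (bounded_measurable_cst c))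
  (aeW _ (fun x n _ => fc n x)).
rewrite -[X in _ --> X]fineK; last first.
  by apply: integrable_fin_num => //; exact: bounded_measurable_integrable.
by move=> /fine_cvgP[].
Qed.

End bounded_expectation.

(** * Factorization of real expectations under independence *)

Section independence.
Import HBNNSimple.
Context {d d' : measure_display} {T : measurableType d}
  {T' : measurableType d'} {R : realType} (P : probability T R).

(** Independence is assumed against indicators of [X] only. Linearity extends it to simple
    functions, and bounded convergence to all bounded measurable [f]. *)
Lemma expectM_indep (G : T -> R) (X : T -> T') (f : T' -> R) :
  bounded_measurable G -> measurable_fun setT X ->
  (forall A : set T', measurable A ->
     \int[P]_x (G x * \1_A (X x)) = \int[P]_x G x * \int[P]_x \1_A (X x)) ->
  bounded_measurable f ->
  \int[P]_x (G x * f (X x)) = \int[P]_x G x * \int[P]_x f (X x).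
Proof.
move=> bG mX GA bf.
(* Approximation from below by simple functions asks for [0 <= f]. With [c] a bound of the absolute
   value of [f], the function [f + c] qualifies, and the extra terms cancel. *)
wlog f0 : f bf / forall y, 0 <= f y.
  move=> H; have [_ [c fc]] := bf.
  have bc : bounded_measurable (fun y : T' => f y + c).
    by apply: bounded_measurableD => //; exact: bounded_measurable_cst.
  have := H _ bc (fun y => _).
  have bfX := bounded_measurable_comp _ _ bf mX.
  under eq_Rintegral do rewrite mulrDr.
  rewrite expectD//; last exact: bounded_measurable_cst.
  rewrite expectD; [|exact: bounded_measurableM|
    by apply: bounded_measurableM => //; exact: bounded_measurable_cst].
  rewrite expect_cst mulrDr.
  under [X in _ + X = _]eq_Rintegral do rewrite mulrC.
  rewrite expectZ// (mulrC c) => /(_ _)/addIr; apply => y.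
  by rewrite -lerBlDr sub0r; have := fc y; rewrite ler_norml => /andP[].
have mf : measurable_fun setT (EFin \o f).
  by apply/measurable_EFinP; case: bf.
pose f_ := nnsfun_approx measurableT mf.
have f_f y : f_ n y @[n --> \oo] --> f y.
  by have /fine_cvgP[] := @cvg_nnsfun_approx _ _ _ _ measurableT _ mf (fun x _ => f0 x) y I.
have le_f n y : f_ n y <= f y.
  have := @le_approx _ _ _ _ (EFin \o f) n y (fun x _ => f0 x) I.
  by rewrite /f_ nnsfun_approxE lee_fin.
have step n : \int[P]_x (G x * f_ n (X x)) = \int[P]_x G x * \int[P]_x f_ n (X x).
  (* A simple function is a finite combination of indicators of its level sets. *)
  under eq_Rintegral do rewrite fimfunE fsbig_finite//= mulr_sumr.
  under [X in _ * X]eq_Rintegral do rewrite fimfunE fsbig_finite//=.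
  have mA y : measurable (f_ n @^-1` [set y]) by exact: measurable_sfunP.
  have bA y := bounded_measurable_comp _ _ (bounded_measurable_indic (R := R) _ (mA y)) mX.
  rewrite !expect_sum; first last.
  - move=> y; apply: bounded_measurableM => //.
    by apply: bounded_measurableM => //; exact: bounded_measurable_cst.
  - by move=> y; apply: bounded_measurableM => //; exact: bounded_measurable_cst.
  rewrite mulr_sumr; apply: eq_bigr => y _.
  under eq_Rintegral do rewrite mulrCA.
  rewrite !expectZ//; last exact: bounded_measurableM.
  by rewrite GA// mulrCA.
have [mG [b Gb]] := bG; have [_ [c fc]] := bf.
have mf_ n : measurable_fun setT (fun x => f_ n (X x)).
  by apply: measurableT_comp.
have f_c n x : `|f_ n (X x)| <= c.
  by rewrite ger0_norm// (le_trans (le_f _ _))// (le_trans (ler_norm _)).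
have [_ cvR] := @bounded_convergence _ _ _ P (fun n x => f_ n (X x)) (fun x => f (X x)) c
  mf_ f_c (fun x => f_f (X x)).
have [_ cvL] := @bounded_convergence _ _ _ P (fun n x => G x * f_ n (X x))
  (fun x => G x * f (X x)) (b * c) (fun n => measurable_funM mG (mf_ n))
  (fun n x => ltac:(by rewrite normrM ler_pM)) (fun x => cvgM (cvg_cst _) (f_f (X x))).
move: cvL; under eq_cvg do rewrite step.
move=> cvL; apply: (cvg_unique _ cvL) => //.
exact: cvgM (cvg_cst (\int[P]_x G x)) cvR.
Qed.

End independence.

(** * Bounded complex random variables and their expectations *)

Section complex_expectation.
Local Open Scope complex_scope.
Context {d : measure_display} {T : measurableType d} {R : realType}.
Implicit Types F G : T -> R[i].

Definition cbounded F :=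
  bounded_measurable (fun x => complex.Re (F x)) /\
  bounded_measurable (fun x => complex.Im (F x)).

Definition cexpect (P : probability T R) F : R[i] :=
  (\int[P]_x complex.Re (F x)) +i* (\int[P]_x complex.Im (F x)).

Lemma ReM (z w : R[i]) : complex.Re (z * w) =
  complex.Re z * complex.Re w - complex.Im z * complex.Im w.
Proof. by case: z; case: w. Qed.

Lemma ImM (z w : R[i]) : complex.Im (z * w) =
  complex.Re z * complex.Im w + complex.Im z * complex.Re w.
Proof. by case: z; case: w. Qed.

Lemma complex_eqP (z w : R[i]) :
  complex.Re z = complex.Re w -> complex.Im z = complex.Im w -> z = w.
Proof. by case: z; case: w => a b c e /= -> ->. Qed.

Lemma cbounded_real (F : T -> R) :
  bounded_measurable F -> cbounded (fun x => (F x)%:C).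
Proof. by move=> bF; split => //; exact: bounded_measurable_cst. Qed.

Lemma cboundedM F G : cbounded F -> cbounded G -> cbounded (fun x => F x * G x).
Proof.
move=> [rF iF] [rG iG]; split.
  under eq_fun do rewrite ReM.
  by apply: bounded_measurableB; exact: bounded_measurableM.
under eq_fun do rewrite ImM.
by apply: bounded_measurableD; exact: bounded_measurableM.
Qed.

Lemma cbounded_prod (I : Type) (r : seq I) (F : I -> T -> R[i]) :
  (forall i, cbounded (F i)) -> cbounded (fun x => \prod_(i <- r) F i x).
Proof.
move=> bF; elim: r => [|i r IH].
  under eq_fun do rewrite big_nil.
  by apply: cbounded_real; exact: bounded_measurable_cst.
by under eq_fun do rewrite big_cons; exact: cboundedM.
Qed.

Lemma cexpect_real P (F : T -> R) :
  cexpect P (fun x => (F x)%:C) = (\int[P]_x F x)%:C.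
Proof. by rewrite /cexpect /= expect_cst. Qed.

Lemma eq_cexpect P F G : F =1 G -> cexpect P F = cexpect P G.
Proof. by move=> /funext ->. Qed.

End complex_expectation.

(** * Expectations of products of independent variables *)

Section product_of_independent.
Local Open Scope complex_scope.
Context {d d' : measure_display} {T : measurableType d}
  {T' : measurableType d'} {R : realType} (P : probability T R).

Lemma cbounded_comp (f : T' -> R[i]) (X : T -> T') :
  cbounded f -> measurable_fun setT X -> cbounded (fun x => f (X x)).
Proof.
by move=> [rf jf] mX; split;
  [exact: bounded_measurable_comp rf mX|exact: bounded_measurable_comp jf mX].
Qed.

(** Real and imaginary parts turn the claim into four real products, each settled by
    [expectM_indep]. *)
Lemma cexpectM_indep (G : T -> R[i]) (X : T -> T') (f : T' -> R[i]) :
  cbounded G -> measurable_fun setT X ->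
  (forall A : set T', measurable A ->
     cexpect P (fun x => G x * (\1_A (X x))%:C) =
     cexpect P G * cexpect P (fun x => (\1_A (X x))%:C)) ->
  cbounded f ->
  cexpect P (fun x => G x * f (X x)) = cexpect P G * cexpect P (fun x => f (X x)).
Proof.
move=> [rG jG] mX GA bf; have [rf jf] := bf.
have [rfX jfX] := cbounded_comp f X bf mX.
(* An indicator is real, so [GA] separates into one identity for each part of [G]. *)
have rGA A : measurable A -> \int[P]_x (complex.Re (G x) * \1_A (X x)) =
    \int[P]_x complex.Re (G x) * \int[P]_x \1_A (X x).
  move=> /GA/(congr1 (@complex.Re R)); rewrite cexpect_real ReM /= mulr0 subr0 => <-.
  by apply: eq_Rintegral => x _; rewrite ReM /= mulr0 subr0.
have jGA A : measurable A -> \int[P]_x (complex.Im (G x) * \1_A (X x)) =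
    \int[P]_x complex.Im (G x) * \int[P]_x \1_A (X x).
  move=> /GA/(congr1 (@complex.Im R)); rewrite cexpect_real ImM /= mulr0 add0r => <-.
  by apply: eq_Rintegral => x _; rewrite ImM /= mulr0 add0r.
apply: complex_eqP.
  rewrite ReM /=; under eq_Rintegral do rewrite ReM.
  rewrite expectB; [|exact: bounded_measurableM..].
  by rewrite (expectM_indep _ _ _ _ rG mX rGA rf) (expectM_indep _ _ _ _ jG mX jGA jf).
rewrite ImM /=; under eq_Rintegral do rewrite ImM.
rewrite expectD; [|exact: bounded_measurableM..].
by rewrite (expectM_indep _ _ _ _ rG mX rGA jf) (expectM_indep _ _ _ _ jG mX jGA rf).
Qed.

Context {I : finType} (X : I -> T -> T').
Hypotheses (mX : forall i, measurable_fun setT (X i))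
  (indepX : mutually_independent P X).

(** The product of the indicators is the indicator of the intersection [B], whose probability
    factors by independence. As [r] has no repetition, the product over its index set is the product
    over the list. *)
Lemma expect_prod_indic (r : seq I) (A : I -> set T') :
  uniq r -> (forall i, measurable (A i)) ->
  \int[P]_x (\prod_(i <- r) \1_(A i) (X i x)) =
  \prod_(i <- r) \int[P]_x \1_(A i) (X i x).
Proof.
move=> ur mA; have := indepX [set i in r]%SET A mA.
have mXA i : measurable (X i @^-1` A i).
  by rewrite -[_ @^-1` _]setTI; exact: mX.
set B := \bigcap_(i in _) _ => PB.
have mB : measurable B by apply: fin_bigcap_measurable.
transitivity (\int[P]_x \1_B x); last first.
  rewrite Rintegral_indic// PB.
  rewrite (eq_bigr (fun i => (\int[P]_x \1_(A i) (X i x))%:E)).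
    rewrite prodEFin /= (big_uniq _ ur); by apply: eq_bigl => i; rewrite inE.
  move=> i _; rewrite (_ : (fun x => \1_(A i) (X i x)) = \1_(X i @^-1` A i)).
    by rewrite Rintegral_indic// fineK// fin_num_measure.
  by apply/funext => x; rewrite !indicE.
apply: eq_Rintegral => x _; rewrite indicE; have [Bx|Bx] := boolP (x \in B).
  rewrite big_seq big1// => i ir; rewrite indicE mem_set//.
  by move: Bx; rewrite inE => /(_ i); apply; rewrite /= inE.
have [i ir nA] : exists2 i, i \in r & ~ A i (X i x).
  apply: contrapT => H; move/negP: Bx; apply; rewrite inE => i /=.
  by rewrite inE => ir; apply: contrapT => nA; apply: H; exists i.
by rewrite (big_rem i)//= indicE memNset// mul0r.
Qed.

(* Functions replace indicators one index at a time, by [cexpectM_indep]. *)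
Lemma cexpect_prod_indic (r r' : seq I) (f : I -> T' -> R[i]) (A : I -> set T') :
  uniq (r ++ r') -> (forall i, cbounded (f i)) -> (forall i, measurable (A i)) ->
  cexpect P (fun x => (\prod_(i <- r) f i (X i x)) *
                      (\prod_(i <- r') (\1_(A i) (X i x))%:C)) =
  (\prod_(i <- r) cexpect P (fun x => f i (X i x))) *
  (\prod_(i <- r') cexpect P (fun x => (\1_(A i) (X i x))%:C)).
Proof.
move=> + bf; elim: r r' A => [|a r IH] r' A.
  rewrite cat0s => ur mA; under eq_cexpect do rewrite big_nil mul1r -rmorph_prod.
  rewrite big_nil mul1r cexpect_real expect_prod_indic// rmorph_prod.
  by apply: eq_bigr => i _; rewrite cexpect_real.
move=> /= /andP[ar ur] mA.
under eq_cexpect do rewrite big_cons -mulrA mulrC.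
rewrite big_cons -mulrA [RHS]mulrC -IH//.
apply: (@cexpectM_indep (fun x => (\prod_(i <- r) f i (X i x)) *
  (\prod_(i <- r') (\1_(A i) (X i x))%:C))) => //.
  apply: cboundedM; apply: cbounded_prod => i; first exact: cbounded_comp.
  apply: cbounded_real.
  by apply: bounded_measurable_comp => //; exact: bounded_measurable_indic.
move=> B mB; rewrite IH//.
(* The index [a] joins [r'] with [B] as its set. By uniqueness [a] does not occur in [r'], so the
   other sets are unchanged and the induction hypothesis applies to [a :: r']. *)
pose A' i := if i == a then B else A i.
have prodA' (F : I -> set T' -> R[i]) :
    \prod_(i <- a :: r') F i (A' i) = F a B * \prod_(i <- r') F i (A i).
  rewrite big_cons {1}/A' eqxx; congr (_ * _).
  rewrite !big_seq; apply: eq_bigr => i ir'; rewrite /A'; case: eqP => // ia.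
  by move: ar; rewrite -ia mem_cat ir' orbT.
have mA' i : measurable (A' i) by rewrite /A'; case: ifP.
have urar' : uniq (r ++ a :: r').
  by rewrite -(cat1s a) uniq_catCA /= ar.
have := IH (a :: r') A' urar' mA'.
rewrite (prodA' (fun i A => cexpect P (fun x => (\1_A (X i x))%:C))).
rewrite mulrCA mulrC => <-.
apply: eq_cexpect => x; rewrite (prodA' (fun i A => (\1_A (X i x))%:C)).
by rewrite -mulrA; congr (_ * _); rewrite mulrC.
Qed.

Lemma cexpect_prod (f : I -> T' -> R[i]) : (forall i, cbounded (f i)) ->
  cexpect P (fun x => \prod_i f i (X i x)) =
  \prod_i cexpect P (fun x => f i (X i x)).
Proof.
move=> bf; have := @cexpect_prod_indic (index_enum I) [::] f (fun=> setT).
rewrite cats0 index_enum_uniq => /(_ isT bf (fun=> measurableT)).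
by rewrite big_nil mulr1 => <-; apply: eq_cexpect => x; rewrite big_nil mulr1.
Qed.

End product_of_independent.

(** * Characteristic functions of affine images and independent sums *)

Section char_fun.
Local Open Scope complex_scope.
Context {d : measure_display} {T : measurableType d} {R : realType}.
Implicit Type P : probability T R.

Definition cis (x : R) : R[i] := cos x +i* sin x.

Lemma cisD x y : cis (x + y) = cis x * cis y.
Proof. by apply: complex_eqP; rewrite /= ?cosD// sinD addrC. Qed.

Lemma cis_sum (I : Type) (r : seq I) (F : I -> R) :
  cis (\sum_(i <- r) F i) = \prod_(i <- r) cis (F i).
Proof.
elim: r => [|i r IH]; last by rewrite !big_cons cisD IH.
by rewrite !big_nil /cis cos0 sin0.
Qed.

Lemma char_funE P (X : T -> R) t :
  char_fun P X t = cexpect P (fun x => cis (t * X x)).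
Proof. by rewrite /char_fun unlock. Qed.

Lemma char_fun_affine P (X : T -> R) a b t : measurable_fun setT X ->
  char_fun P (fun x => a * X x + b) t = char_fun P X (t * a) * cis (t * b).
Proof.
move=> mX; rewrite !char_funE.
have bC : bounded_measurable (fun x => cos (t * a * X x)).
  exact: bounded_measurable_comp (bounded_measurable_cos (t * a)) mX.
have bS : bounded_measurable (fun x => sin (t * a * X x)).
  exact: bounded_measurable_comp (bounded_measurable_sin (t * a)) mX.
under eq_cexpect do rewrite mulrDr mulrA cisD.
apply: complex_eqP => /=.
  rewrite expectB; [|apply: bounded_measurableM => //; exact: bounded_measurable_cst..].
  by rewrite !RintegralZr//; exact: bounded_measurable_integrable.
rewrite expectD; [|apply: bounded_measurableM => //; exact: bounded_measurable_cst..].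
by rewrite !RintegralZr//; exact: bounded_measurable_integrable.
Qed.

End char_fun.

(** The value space [T'] is arbitrary so that the statement serves both the independent coordinates
    of one noise vector and the independent noise vectors. *)
Lemma char_fun_sum {d d' : measure_display} {T : measurableType d}
    {T' : measurableType d'} {R : realType} (P : probability T R)
    {I : finType} (X : I -> T -> T') (w : I -> T' -> R) t :
  (forall i, measurable_fun setT (X i)) -> mutually_independent P X ->
  (forall i, measurable_fun setT (w i)) ->
  char_fun P (fun x => \sum_i w i (X i x)) t =
  \prod_i char_fun P (fun x => w i (X i x)) t.
Proof.
move=> mX indepX mw.
transitivity (cexpect P (fun x => \prod_i cis (t * w i (X i x)))).
  by rewrite char_funE; apply: eq_cexpect => x; rewrite mulr_sumr cis_sum.
under [RHS]eq_bigr do rewrite char_funE.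
apply: (@cexpect_prod _ _ _ _ _ P _ X mX indepX (fun i y => cis (t * w i y))) => i.
split.
  exact: bounded_measurable_comp (bounded_measurable_cos t) (mw i).
exact: bounded_measurable_comp (bounded_measurable_sin t) (mw i).
Qed.

(** * Trigonometric polynomials and threshold functions *)

Inductive trig_poly {R : realType} : (R -> R) -> Prop :=
| trig_cos t : trig_poly (fun x => cos (t * x))
| trig_sin t : trig_poly (fun x => sin (t * x))
| trigD f g : trig_poly f -> trig_poly g -> trig_poly (fun x => f x + g x)
| trigZ c f : trig_poly f -> trig_poly (fun x => c * f x).

Section trig_poly.
Context {R : realType}.
Implicit Types f g : R -> R.

Lemma trig_cst c : trig_poly (fun=> c : R).
Proof.
rewrite (_ : (fun=> c) = fun x : R => c * cos (0 * x)); last first.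
  by apply/funext => x; rewrite mul0r cos0 mulr1.
exact/trigZ/trig_cos.
Qed.

Lemma trigB f g : trig_poly f -> trig_poly g -> trig_poly (fun x => f x - g x).
Proof.
move=> tf tg; rewrite (_ : (fun x => _) = fun x => f x + (-1) * g x).
  exact/trigD/trigZ.
by apply/funext => x; rewrite mulN1r.
Qed.

(** The constructors give linear combinations only; products of generators come back to them by the
    product-to-sum formulas. *)
Lemma trigM f g : trig_poly f -> trig_poly g -> trig_poly (fun x => f x * g x).
Proof.
have cc t s : trig_poly (fun x : R => cos (t * x) * cos (s * x)).
  rewrite (_ : (fun x => _) = fun x =>
      2^-1 * (cos ((t - s) * x) + cos ((t + s) * x))).
    by apply/trigZ/trigD; exact: trig_cos.
  by apply/funext => x; rewrite mulrBl mulrDl cosB cosD; field.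
have ss t s : trig_poly (fun x : R => sin (t * x) * sin (s * x)).
  rewrite (_ : (fun x => _) = fun x =>
      2^-1 * (cos ((t - s) * x) - cos ((t + s) * x))).
    by apply/trigZ/trigB; exact: trig_cos.
  by apply/funext => x; rewrite mulrBl mulrDl cosB cosD; field.
have cs t s : trig_poly (fun x : R => cos (t * x) * sin (s * x)).
  rewrite (_ : (fun x => _) = fun x =>
      2^-1 * (sin ((t + s) * x) - sin ((t - s) * x))).
    by apply/trigZ/trigB; exact: trig_sin.
  by apply/funext => x; rewrite mulrBl mulrDl sinB sinD; field.
move=> tf tg; elim: tf => {f} [t|t|f1 f2 _ IH1 _ IH2|c f _ IH]; last 2 first.
- by under eq_fun do rewrite mulrDl; exact: trigD.
- by under eq_fun do rewrite -mulrA; exact: trigZ.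
- elim: tg => {g} [s|s|g1 g2 _ IH1 _ IH2|c g _ IH]; [exact: cc|exact: cs| |].
  + by under eq_fun do rewrite mulrDr; exact: trigD.
  + by under eq_fun do rewrite mulrCA; exact: trigZ.
- elim: tg => {g} [s|s|g1 g2 _ IH1 _ IH2|c g _ IH]; [|exact: ss| |].
  + by under eq_fun do rewrite mulrC; exact: cs.
  + by under eq_fun do rewrite mulrDr; exact: trigD.
  + by under eq_fun do rewrite mulrCA; exact: trigZ.
Qed.

Lemma trigX f n : trig_poly f -> trig_poly (fun x => f x ^+ n).
Proof.
move=> tf; elim: n => [|n IH].
  by under eq_fun do rewrite expr0; exact: trig_cst.
by under eq_fun do rewrite exprS; exact: trigM.
Qed.

Lemma trig_sin_shift t a : trig_poly (fun x : R => sin (t * (x - a))).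
Proof.
under eq_fun do rewrite mulrBr sinB (mulrC (sin _)).
by apply: trigB; [apply: trigZ; exact: trig_sin|
  under eq_fun do rewrite mulrC; apply: trigZ; exact: trig_cos].
Qed.

Lemma bounded_measurable_trig f : trig_poly f -> bounded_measurable f.
Proof.
elim=> {f} [t|t|f g _ bf _ bg|c f _ bf].
- exact: bounded_measurable_cos.
- exact: bounded_measurable_sin.
- exact: bounded_measurableD.
- by apply: bounded_measurableM => //; exact: bounded_measurable_cst.
Qed.

Lemma bernoulli_ineq (x : R) n : -1 <= x -> 1 + n%:R * x <= (1 + x) ^+ n.
Proof.
move=> x1; elim: n => [|n IH]; first by rewrite mul0r addr0 expr0.
rewrite exprS; apply: (@le_trans _ _ ((1 + x) * (1 + n%:R * x))).
  rewrite -natr1 -subr_ge0.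
  rewrite (_ : _ - _ = n%:R * x ^+ 2); last by ring.
  by rewrite mulr_ge0// sqr_ge0.
by rewrite ler_wpM2l// -lerBlDl sub0r.
Qed.

(* The factor [n] in the exponent makes the limit at the critical point [s = 1]
   equal to [0]; without it that limit would be [exp (-1)]. *)
Definition threshold (n : nat) (s : R) : R :=
  (1 - (s ^+ 2 / 4) ^+ n) ^+ (n * 4 ^ n)%N.

Lemma threshold_itv n s : 0 <= s <= 2 -> 0 <= threshold n s <= 1.
Proof.
move=> /andP[s0 s2].
have h : 0 <= (s ^+ 2 / 4) ^+ n <= 1.
  apply/andP; split; first by rewrite exprn_ge0// divr_ge0// sqr_ge0.
  rewrite exprn_ile1// ?divr_ge0 ?sqr_ge0// ler_pdivrMr// mul1r; nra.
by apply/andP; split; [apply: exprn_ge0|apply: exprn_ile1]; lra.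
Qed.

(** Put w = (s^2/4)^n and N = n 4^n. Then (1 - w)^N (1 + w)^N <= 1, while Bernoulli gives (1 + w)^N
    >= 1 + N w = 1 + n s^(2n) >= n + 1. Hence the threshold is at most 1/(n + 1). *)
Lemma threshold_cvg0 s : 1 <= s <= 2 -> threshold n s @[n --> \oo] --> (0 : R).
Proof.
move=> /andP[s1 s2].
have s02 : 0 <= s <= 2 by rewrite s2 (le_trans _ s1).
apply: (@squeeze_cvgr _ _ _ _ (fun=> 0) harmonic).
- near=> n; have /andP[-> _] := threshold_itv n s s02; rewrite andTb /harmonic /=.
  have w0 : 0 <= (s ^+ 2 / 4) ^+ n by rewrite exprn_ge0// divr_ge0// sqr_ge0.
  have w1 : (s ^+ 2 / 4) ^+ n <= 1.
    rewrite exprn_ile1// ?divr_ge0 ?sqr_ge0// ler_pdivrMr// mul1r; nra.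
  have w4 : 1 <= 4 ^+ n * (s ^+ 2 / 4) ^+ n.
    by rewrite -exprMn mulrCA divff// mulr1 exprn_ege1// exprn_ege1.
  rewrite -[X in _ <= X]mul1r ler_pdivlMr//.
  apply: (@le_trans _ _ ((1 - (s ^+ 2 / 4) ^+ n) ^+ (n * 4 ^ n) *
                         (1 + (s ^+ 2 / 4) ^+ n) ^+ (n * 4 ^ n))); last first.
    rewrite -exprMn exprn_ile1//; nra.
  rewrite ler_wpM2l//; first by rewrite exprn_ge0// subr_ge0.
  apply: le_trans (bernoulli_ineq _ _ _); last by rewrite (le_trans _ w0).
  rewrite -natr1 addrC lerD2l natrM natrX -mulrA -[X in X <= _]mulr1.
  by rewrite ler_wpM2l.
- exact: cvg_cst.
- exact: cvg_harmonic.
Unshelve. all: by end_near. Qed.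

(** Bernoulli bounds the threshold below by 1 - n s^(2n), and [bnd] bounds n s^n by s / (1 - s),
    leaving a factor s^n that tends to 0. *)
Lemma threshold_cvg1 s : 0 <= s < 1 -> threshold n s @[n --> \oo] --> (1 : R).
Proof.
move=> /andP[s0 s1].
have s02 : 0 <= s <= 2 by lra.
(* Bernoulli for the n-th power of 1/s, multiplied by s^n; the case s = 0 is direct. *)
have bnd n : n%:R * s ^+ n * (1 - s) <= s.
  have [->|sn0] := eqVneq s 0.
    by case: n => [|n]; rewrite ?mul0r// expr0n/= mulr0 mul0r.
  have sp : 0 < s by rewrite lt_neqAle eq_sym sn0.
  have sV : -1 <= s^-1 - 1 by rewrite lerBrDl subrr invr_ge0.
  have := bernoulli_ineq (s^-1 - 1) n sV; rewrite [X in _ <= X ^+ n]addrC subrK.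
  move=> /(ler_wpM2r (exprn_ge0 n s0)); rewrite -exprMn mulVf// expr1n.
  have -> : (1 + n%:R * (s^-1 - 1)) * s ^+ n =
      (s * s ^+ n + n%:R * (1 - s) * s ^+ n) / s by field.
  rewrite ler_pdivrMr// mul1r.
  have := mulr_ge0 s0 (exprn_ge0 n s0); lra.
apply: (@squeeze_cvgr _ _ _ _ (fun n => 1 - s / (1 - s) * s ^+ n) (fun=> 1)).
- near=> n; have /andP[_ ->] := threshold_itv n s s02; rewrite andbT.
  have w0 : 0 <= (s ^+ 2 / 4) ^+ n by rewrite exprn_ge0// divr_ge0// sqr_ge0.
  have w1 : (s ^+ 2 / 4) ^+ n <= 1.
    rewrite exprn_ile1// ?divr_ge0 ?sqr_ge0// ler_pdivrMr// mul1r; nra.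
  apply: le_trans (bernoulli_ineq _ _ _); last by rewrite lerNr opprK.
  rewrite mulrN lerD2l lerN2.
  have -> : (n * 4 ^ n)%N%:R * (s ^+ 2 / 4) ^+ n = n%:R * s ^+ n * s ^+ n.
    by rewrite natrM natrX -mulrA -exprMn mulrCA divff// mulr1 -!mulrA -exprMn expr2.
  by rewrite ler_wpM2r ?exprn_ge0// ler_pdivlMr// subr_gt0.
- rewrite -[X in _ --> X]subr0; apply: cvgB; first exact: cvg_cst.
  rewrite -(mulr0 (s / (1 - s))); apply: cvgM; first exact: cvg_cst.
  by apply: cvg_expr; rewrite ger0_norm.
- exact: cvg_cst.
Unshelve. all: by end_near. Qed.

End trig_poly.

(** * A characteristic function determines the law on open half-lines *)

Section uniqueness.
Context {R : realType} {d d' : measure_display} {T : measurableType d}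
  {T' : measurableType d'} (P : probability T R) (P' : probability T' R)
  (X : T -> R) (Y : T' -> R).
Hypotheses (mX : measurable_fun setT X) (mY : measurable_fun setT Y)
  (XY : forall t, char_fun P X t = char_fun P' Y t).

(** The two parts of the characteristic function handle the generators; linearity of expectation
    handles the other constructors. *)
Lemma char_fun_trig f : trig_poly f ->
  \int[P]_x f (X x) = \int[P']_y f (Y y).
Proof.
elim=> {f} [t|t|f g tf IHf tg IHg|c f tf IHf].
- by have := congr1 (@complex.Re R) (XY t); rewrite /char_fun unlock.
- by have := congr1 (@complex.Im R) (XY t); rewrite /char_fun unlock.
- have bf := bounded_measurable_trig _ tf; have bg := bounded_measurable_trig _ tg.
  have comp := bounded_measurable_comp.
  rewrite !expectD ?IHf ?IHg//; first [exact: comp bf mX|exact: comp bg mX|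
    exact: comp bf mY|exact: comp bg mY].
- have bf := bounded_measurable_trig _ tf.
  have comp := bounded_measurable_comp.
  rewrite !expectZ ?IHf//; first [exact: comp bf mX|exact: comp bf mY].
Qed.

(** Equality of expectations survives bounded pointwise limits; it is used for two nested limits. *)
Lemma expect_limit_eq (f : nat -> R -> R) (l : R -> R) c :
  (forall n, measurable_fun setT (f n)) ->
  (forall n x, `|f n x| <= c) -> (forall x, f n x @[n --> \oo] --> l x) ->
  (forall n, \int[P]_x f n (X x) = \int[P']_y f n (Y y)) ->
  \int[P]_x l (X x) = \int[P']_y l (Y y).
Proof.
move=> mf fc fl fXY.
have [_ cX] := @bounded_convergence _ _ _ P (fun n x => f n (X x)) (fun x => l (X x)) c
  (fun n => measurableT_comp (mf n) mX) (fun n x => fc n (X x)) (fun x => fl (X x)).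
have [_ cY] := @bounded_convergence _ _ _ P' (fun n x => f n (Y x)) (fun x => l (Y x)) c
  (fun n => measurableT_comp (mf n) mY) (fun n x => fc n (Y x)) (fun x => fl (Y x)).
move: cX; under eq_cvg do rewrite fXY.
by move=> cX; apply: (cvg_unique _ cX cY).
Qed.

(** Once the argument has absolute value below 1 < pi, its sine has the same sign as [y]. *)
Lemma sin_lt0_near (y : R) : \forall n \near \oo, (sin (harmonic n * y) < 0) = (y < 0).
Proof.
have : (fun n => harmonic n * y) n @[n --> \oo] --> (0 : R).
  by rewrite -(mul0r y); apply: cvgM; [exact: cvg_harmonic|exact: cvg_cst].
move=> /cvgr0_norm_lt/(_ 1 ltr01); apply: filterS => n.
have h0 : 0 < harmonic n :> R by rewrite /harmonic/= invr_gt0 ltr0n.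
have pi1 : 1 < pi :> R by have := pi_ge2 R; lra.
rewrite ltr_norml => /andP[]; move: (harmonic n) h0 => t h0 h1 h2.
have [y0|y0|->] := ltgtP y 0.
- have : 0 < sin (- (t * y)).
    by apply: sin_gt0_pi; rewrite oppr_gt0 pmulr_rlt0// y0/=; lra.
  by rewrite sinN oppr_gt0.
- apply/negbTE; rewrite -leNgt ltW// sin_gt0_pi// mulr_gt0//=; lra.
- by rewrite mulr0 sin0 ltxx.
Qed.

Lemma measurable_lt0 (f : R -> R) : measurable_fun setT f ->
  measurable_fun setT (fun x : R => (f x < 0)%R%:R : R).
Proof.
move=> mf; rewrite (_ : (fun x => _) = \1_(f @^-1` `]-oo, 0[)).
  by apply: measurable_indic; rewrite -[_ @^-1` _]setTI; apply: mf.
by apply/funext => x; rewrite indicE; congr ((nat_of_bool _)%:R);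
  apply/idP/idP; rewrite inE /= in_itv.
Qed.

Lemma char_fun_expect_lt a :
  \int[P]_x (X x - a < 0)%R%:R = \int[P']_y (Y y - a < 0)%R%:R :> R.
Proof.
have tS k : trig_poly (fun x : R => 1 + sin (harmonic k * (x - a))).
  by apply: trigD; [exact: trig_cst|exact: trig_sin_shift].
have S02 k x : 0 <= 1 + sin (harmonic k * (x - a)) <= 2.
  by have := sin_geN1 (harmonic k * (x - a)); have := sin_le1 (harmonic k * (x - a)); lra.
have tT n k : trig_poly (fun x : R => threshold n (1 + sin (harmonic k * (x - a)))).
  apply/trigX/trigB; first exact: trig_cst.
  apply/trigX; under eq_fun do rewrite mulrC; exact/trigZ/trigX.
(* Outer limit, with the frequency [harmonic k] tending to 0. *)
apply: (expect_limit_eq (fun k x => (sin (harmonic k * (x - a)) < 0)%R%:R)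
  (fun x => (x - a < 0)%R%:R) 1).
- move=> k; apply: measurable_lt0.
  by have [] := bounded_measurable_trig _ (trig_sin_shift (harmonic k) a).
- by move=> k x; case: (_ < _); rewrite ?normr1 ?normr0.
- move=> x; apply: cvg_near_cst.
  by have := sin_lt0_near (x - a); apply: filterS => k ->.
(* Inner limit at a fixed frequency: [1 + sin] lies in [0, 2] and is below 1 exactly when the sine
   is negative. *)
move=> k; apply: (expect_limit_eq
  (fun n x => threshold n (1 + sin (harmonic k * (x - a))))
  (fun x => (sin (harmonic k * (x - a)) < 0)%R%:R) 1).
- by move=> n; have [] := bounded_measurable_trig _ (tT n k).
- move=> n x; have /andP[t0 t1] := threshold_itv n _ (S02 k x).
  by rewrite ger0_norm.
- move=> x; case: ltP => s0.
    by apply: threshold_cvg1; have := S02 k x; lra.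
  by apply: threshold_cvg0; have := S02 k x; lra.
- by move=> n; exact: char_fun_trig (tT n k).
Qed.

Lemma char_fun_lt a : P [set x | X x < a] = P' [set y | Y y < a].
Proof.
have H (e : measure_display) (U : measurableType e) (Q : probability U R) (Z : U -> R) :
    measurable_fun setT Z -> (\int[Q]_x (Z x - a < 0)%R%:R)%:E = Q [set x | Z x < a].
  move=> mZ; have mA : measurable [set x | Z x < a].
    rewrite (_ : mkset _ = Z @^-1` `]-oo, a[); last first.
      by apply/seteqP; split => x /=; rewrite in_itv.
    by rewrite -[_ @^-1` _]setTI; apply: mZ.
  rewrite (_ : (fun x => _) = \1_[set x | Z x < a]).
    by rewrite Rintegral_indic// fineK// fin_num_measure.
  by apply/funext => x; rewrite indicE subr_lt0; congr ((nat_of_bool _)%:R);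
    apply/idP/idP; rewrite inE.
by rewrite -!H// char_fun_expect_lt.
Qed.

End uniqueness.

(** * Absence of an atom at 0 when the characteristic function vanishes at infinity *)

Section no_atom.
Context {R : realType} {d : measure_display} {T : measurableType d}
  (P : probability T R) (X : T -> R).
Hypotheses (mX : measurable_fun setT X)
  (cos0 : \int[P]_x cos (s * X x) @[s --> +oo] --> (0 : R))
  (sin0 : \int[P]_x sin (s * X x) @[s --> +oo] --> (0 : R)).

Let bmX f : trig_poly f -> bounded_measurable (fun x => f (X x)).
Proof. by move=> tf; exact: bounded_measurable_comp (bounded_measurable_trig _ tf) mX. Qed.

(** Multiplying a generator of frequency [t] by cos (s x) moves its frequencies to s - t and s + t,
    which tend to infinity with [s]. *)
Lemma expect_trig_cos_cvg0 f : trig_poly f ->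
  \int[P]_x (f (X x) * cos (s * X x)) @[s --> +oo] --> (0 : R).
Proof.
have shift t : (s + t) @[s --> +oo] --> (+oo : set_system R).
  apply/cvgryPge => A; near=> s; rewrite -lerBlDr; near: s.
  by apply: nbhs_pinfty_ge; exact: num_real.
have bc t : bounded_measurable (fun x => cos (t * X x)) by exact: bmX (trig_cos t).
have bs t : bounded_measurable (fun x => sin (t * X x)) by exact: bmX (trig_sin t).
elim=> {f} [t|t|f g tf IHf tg IHg|c f tf IHf].
- have E s : \int[P]_x (cos (t * X x) * cos (s * X x)) =
      2^-1 * (\int[P]_x cos ((s + - t) * X x) + \int[P]_x cos ((s + t) * X x)).
    rewrite -expectD// -expectZ; last exact: bounded_measurableD.
    by apply: eq_Rintegral => x _; rewrite mulrBl mulrDl cosB cosD; field.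
  under eq_cvg do rewrite E.
  have := cvgM (cvg_cst (2^-1 : R)) (cvgD (cvg_comp _ _ (shift (- t)) cos0)
    (cvg_comp _ _ (shift t) cos0)).
  by rewrite addr0 mulr0 => H; exact: H.
- have E s : \int[P]_x (sin (t * X x) * cos (s * X x)) =
      2^-1 * (\int[P]_x sin ((s + t) * X x) - \int[P]_x sin ((s + - t) * X x)).
    rewrite -expectB// -expectZ; last exact: bounded_measurableB.
    by apply: eq_Rintegral => x _; rewrite mulrBl mulrDl sinB sinD; field.
  under eq_cvg do rewrite E.
  have := cvgM (cvg_cst (2^-1 : R)) (cvgB (cvg_comp _ _ (shift t) sin0)
    (cvg_comp _ _ (shift (- t)) sin0)).
  by rewrite subr0 mulr0 => H; exact: H.
- under eq_cvg => s.
    under eq_Rintegral do rewrite mulrDl.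
    rewrite expectD; [over| |];
      by apply: bounded_measurableM => //; exact: bmX.
  by have := cvgD IHf IHg; rewrite addr0 => H; exact: H.
- under eq_cvg => s.
    under eq_Rintegral do rewrite -mulrA.
    rewrite expectZ; [over|].
    by apply: bounded_measurableM => //; exact: bmX.
  by have := cvgM (cvg_cst c) IHf; rewrite mulr0 => H; exact: H.
Unshelve. all: by end_near. Qed.

(* Multiplying by [(1 + cos (s x)) / 2] almost halves the expectation when [s] is large. *)
Lemma trig_majorant n : exists2 f, trig_poly f &
  [/\ forall x, 0 <= f x, f 0 = 1 & \int[P]_x f (X x) <= (3 / 4) ^+ n].
Proof.
elim: n => [|n [f tf [f0 f1 fn]]].
  exists (fun=> 1); first exact: trig_cst.
  by split=> //; rewrite expect_cst expr0.
(* With q = (3/4)^n, a cosine term below q/2 gives (q + q/2)/2 = (3/4) q. *)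
have q0 : 0 < (3 / 4 : R) ^+ n / 2 by rewrite divr_gt0// exprn_gt0// divr_gt0.
have := expect_trig_cos_cvg0 _ tf; move=> /cvgr0_norm_lt/(_ _ q0).
move=> /filter_ex[s /ltW sn].
exists (fun x => 2^-1 * (f x + f x * cos (s * x))).
  by apply: trigZ; apply: trigD => //; apply: trigM => //; exact: trig_cos.
split.
- move=> x; have := cos_geN1 (s * x); have := f0 x; nra.
- by rewrite mulr0 trigo.cos0 f1; lra.
have bfc : bounded_measurable (fun x => f (X x) * cos (s * X x)).
  by apply: bmX (trigM _ _ tf (trig_cos s)).
rewrite expectZ; last by apply: bounded_measurableD => //; exact: bmX.
rewrite expectD//; last exact: bmX.
rewrite exprS; have := ler_norm (\int[P]_x (f (X x) * cos (s * X x))); lra.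
Qed.

(** Each function from [trig_majorant] dominates the indicator of 0, so the probability is at most
    (3/4)^n for every n. *)
Lemma char_fun_no_atom : P [set x | X x = 0] = 0%E.
Proof.
have mA : measurable [set x | X x = 0].
  by rewrite (_ : mkset _ = X @^-1` [set 0])// -[_ @^-1` _]setTI; exact: mX.
rewrite -[LHS]fineK; last exact: fin_num_measure.
congr EFin; apply/eqP; rewrite eq_le fine_ge0// andbT.
have lim : (3 / 4 : R) ^+ n @[n --> \oo] --> (0 : R).
  by apply: cvg_expr; rewrite ger0_norm; lra.
apply: (ler_cvg_to (cvg_cst _) lim); apply: nearW => n.
have [f tf [f0 f1 fn]] := trig_majorant n.
apply: le_trans fn; rewrite -Rintegral_indic//; apply: le_expect.
- exact: bounded_measurable_indic.
- exact: bmX.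
move=> x; rewrite indicE; case: (boolP (x \in _)) => //.
by rewrite inE => /= ->; rewrite f1.
Qed.

End no_atom.

(** * Stable characteristic functions in polar form *)

Section stable_exponent.
Local Open Scope complex_scope.
Context {R : realType}.
Implicit Types a b c l t : R.

(** A single factor for both cases of the stable law. The minus sign at a = 1 reflects the opposite
    sign of the skewness term in that case. *)
Definition stable_skew a t : R :=
  if a != 1 then tan (pi * a / 2) else - (2 / pi) * ln `|t|.

Definition stable_phase a b c l t : R :=
  c `^ a * `|t| `^ a * (b * Num.sg t * stable_skew a t) + l * t.

(** The exponential of r + ix, with both exponents kept real so that products become two real
    sums. *)
Definition polar (r x : R) : R[i] := (expR r)%:C * cis x.

Lemma polarD r x r' x' : polar (r + r') (x + x') = polar r x * polar r' x'.
Proof. by rewrite /polar expRD cisD rmorphM mulrACA. Qed.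

Lemma polar_sum (I : finType) (r x : I -> R) :
  polar (\sum_i r i) (\sum_i x i) = \prod_i polar (r i) (x i).
Proof.
rewrite /polar cis_sum expR_sum rmorph_prod -big_split //.
Qed.

Lemma stable_char_funE a b c l t : 0 <= c ->
  stable_char_fun a b c l t =
  polar (- (c `^ a * `|t| `^ a)) (stable_phase a b c l t).
Proof.
move=> c0; rewrite /stable_char_fun /stable_phase /stable_skew.
have [->|a1] := eqVneq a 1.
  rewrite !powRr1// /cexp /polar; congr ((expR _)%:C * cis _); rewrite /=; ring.
rewrite /cexp /polar; congr ((expR _)%:C * cis _); rewrite /=; ring.
Qed.

End stable_exponent.

(** * Powers of the transferred scale and skewness parameters *)

Section parameters.
Context {R : realType} {D M : nat} (alpha : R) (beta gamma delta : 'I_M -> R)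
  (g : 'I_M -> 'rV[R]_D -> R).
Hypotheses (alpha0 : 0 < alpha) (gamma0 : forall m, 0 < gamma m).

Lemma gamma'_powR x :
  gamma' alpha gamma g x `^ alpha = \sum_(m < M) `|gamma m * g m x| `^ alpha.
Proof.
rewrite /gamma' -powRrM div1r mulVf ?gt_eqF// powRr1//.
by apply: sumr_ge0 => m _; exact: powR_ge0.
Qed.

Lemma gamma''_powR x1 x2 : gamma'' alpha gamma g x1 x2 `^ alpha =
  gamma' alpha gamma g x1 `^ alpha + gamma' alpha gamma g x2 `^ alpha.
Proof.
rewrite /gamma'' -powRrM div1r mulVf ?gt_eqF// powRr1//.
by rewrite addr_ge0// powR_ge0.
Qed.

(** If the denominator of [beta'] is 0, it is a vanishing sum of nonnegative terms, so each term of
    the numerator is 0 as well. *)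
Lemma beta'_gamma' x :
  beta' alpha beta gamma g x * gamma' alpha gamma g x `^ alpha =
  \sum_(m < M) beta m * Num.sg (g m x) * `|gamma m * g m x| `^ alpha.
Proof.
have E m : `|g m x * gamma m| = `|gamma m * g m x| by rewrite mulrC.
rewrite /beta'; under eq_bigr do rewrite E.
have [/eqP G0|G0] := eqVneq (gamma' alpha gamma g x `^ alpha) 0; last by rewrite divfK.
move/eqP: G0 => G0; rewrite G0 mulr0; symmetry; rewrite big1// => m _.
move: G0 => /eqP; rewrite gamma'_powR psumr_eq0; last by move=> *; exact: powR_ge0.
by move=> /allP/(_ m (mem_index_enum _))/eqP ->; rewrite mulr0.
Qed.

End parameters.

Lemma sum_pair2 (V : zmodType) (K : nat) (F : 'I_2 -> 'I_K -> V) :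
  \sum_(ik : 'I_2 * 'I_K) F ik.1 ik.2 =
  \sum_(k < K) F ord0 k + \sum_(k < K) F ord_max k.
Proof.
rewrite -(pair_bigA _ F) /= big_ord_recl big_ord1.
by rewrite (_ : lift _ _ = ord_max)//; exact: val_inj.
Qed.

Lemma sum_pair_fst (R : pzRingType) (K : nat) (F : 'I_2 -> R) :
  \sum_(ik : 'I_2 * 'I_K) F ik.1 = K%:R * (F ord0 + F ord_max).
Proof.
by rewrite (sum_pair2 _ _ (fun i _ => F i)) !sumr_const card_ord mulrDr !mulr_natl.
Qed.

(** * Modulus and phase of the standardized averaged difference *)

Section averaged_exponent.
Context {R : realType} {D M K : nat} (alpha : R) (beta gamma delta : 'I_M -> R)
  (g : 'I_M -> 'rV[R]_D -> R) (x1 x2 : 'rV[R]_D).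
Hypotheses (K0 : (0 < K)%N) (alpha0 : 0 < alpha) (gamma0 : forall m, 0 < gamma m)
  (gamma''0 : gamma'' alpha gamma g x1 x2 != 0).

Let G := gamma'' alpha gamma g x1 x2.

(* [K / ave_scale] times the averaged noise has unit scale. *)
Definition ave_scale : R := K%:R `^ (1 / alpha) * gamma'' alpha gamma g x1 x2.

Definition input_at (i : 'I_2) := if i == ord0 then x1 else x2.

Definition input_sign (i : 'I_2) : R := if i == ord0 then 1 else -1.

(** The coefficient of one copy of noise [m] at input [i] in [K / ave_scale] times the averaged
    difference; the factor 1/K of the average has cancelled. *)
Definition ave_weight (i : 'I_2) (m : 'I_M) : R :=
  input_sign i * g m (input_at i) / ave_scale.

Lemma gamma''_gt0 : 0 < G.
Proof. by rewrite lt_neqAle eq_sym gamma''0 powR_ge0. Qed.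

Lemma ave_scale_gt0 : 0 < ave_scale.
Proof. by rewrite mulr_gt0 ?gamma''_gt0// powR_gt0// ltr0n. Qed.

Lemma ave_scale_powR : ave_scale `^ alpha = K%:R * G `^ alpha.
Proof.
rewrite powRM ?powR_ge0// -powRrM div1r mulVf ?gt_eqF// powRr1//.
Qed.

Let Ga_gt0 : 0 < G `^ alpha. Proof. by rewrite powR_gt0// gamma''_gt0. Qed.
Let Kn0 : K%:R != 0 :> R. Proof. by rewrite pnatr_eq0 -lt0n. Qed.

Lemma ave_weight_powR t i m :
  gamma m `^ alpha * `|t * ave_weight i m| `^ alpha =
  `|t| `^ alpha * `|gamma m * g m (input_at i)| `^ alpha / (K%:R * G `^ alpha).
Proof.
have l0 := ave_scale_gt0.
apply: (@mulIf _ (ave_scale `^ alpha)); first by rewrite gt_eqF// powR_gt0.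
rewrite -[X in _ / X]ave_scale_powR divfK; last by rewrite gt_eqF// powR_gt0.
rewrite -!powRM ?mulr_ge0 ?normr_ge0 ?(ltW l0) ?(ltW (gamma0 m))//;
  last exact: ltW gamma''_gt0.
congr (_ `^ _); rewrite /ave_weight !normrM normfV (gtr0_norm l0) (gtr0_norm (gamma0 m)).
have -> : `|input_sign i| = 1 by rewrite /input_sign; case: eqP => _; rewrite ?normrN normr1.
by field; rewrite gt_eqF.
Qed.

Lemma ave_weight_sg t i m :
  Num.sg (t * ave_weight i m) = Num.sg t * input_sign i * Num.sg (g m (input_at i)).
Proof.
have l0 := ave_scale_gt0.
rewrite /ave_weight !sgrM sgrV (gtr0_sg l0) mulr1 mulrA; congr (_ * _ * _).
by rewrite /input_sign; case: eqP => _; rewrite ?sgrN sgr1.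
Qed.

(** The [K] copies at both inputs contribute [K] times the sum of the two powers of [gamma'], which
    is exactly the power of [ave_scale] in the denominator. *)
Lemma ave_modulus t :
  \sum_(ik : 'I_2 * 'I_K) \sum_m
    - (gamma m `^ alpha * `|t * ave_weight ik.1 m| `^ alpha) =
  - (1 `^ alpha * `|t| `^ alpha).
Proof.
rewrite powR1 mul1r.
have E i : \sum_m - (gamma m `^ alpha * `|t * ave_weight i m| `^ alpha) =
    - `|t| `^ alpha / (K%:R * G `^ alpha) * gamma' alpha gamma g (input_at i) `^ alpha.
  rewrite gamma'_powR// mulr_sumr; apply: eq_bigr => m _.
  rewrite ave_weight_powR. by rewrite !mulNr mulrAC.
rewrite (sum_pair_fst _ _ (fun i =>
  \sum_m - (gamma m `^ alpha * `|t * ave_weight i m| `^ alpha))) !E /input_at /=.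
have := gamma''_powR alpha gamma g alpha0 x1 x2; rewrite -/G => GE.
rewrite -mulrDr -GE; move: (G `^ alpha) (`|t| `^ alpha) Ga_gt0 => u v u0.
by field; rewrite Kn0 gt_eqF.
Qed.

(** The location terms are linear in [t] and form the last summand. The skewness terms form [beta'']
    and, when [alpha] is 1, also [delta_ave]. *)
Lemma ave_phase t :
  \sum_(ik : 'I_2 * 'I_K) \sum_m
     stable_phase alpha (beta m) (gamma m) (delta m) (t * ave_weight ik.1 m) =
  stable_phase alpha (beta'' alpha beta gamma g x1 x2) 1
    (delta_ave alpha beta gamma g K x1 x2) t
  + t * (K%:R / ave_scale * (\sum_m g m x1 * delta m - \sum_m g m x2 * delta m)).
Proof.
have l0 := ave_scale_gt0.
under eq_bigr do rewrite big_split /=.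
rewrite big_split /=.
have -> : \sum_(ik : 'I_2 * 'I_K) \sum_m delta m * (t * ave_weight ik.1 m) =
  t * (K%:R / ave_scale * (\sum_m g m x1 * delta m - \sum_m g m x2 * delta m)).
  have E i : \sum_m delta m * (t * ave_weight i m) =
      t / ave_scale * (input_sign i * \sum_m g m (input_at i) * delta m).
    rewrite !mulr_sumr; apply: eq_bigr => m _; rewrite /ave_weight.
    by field; rewrite gt_eqF.
  rewrite (sum_pair_fst _ _ (fun i => \sum_m delta m * (t * ave_weight i m))) !E.
  by rewrite /input_sign /input_at /=; field; rewrite gt_eqF.
congr (_ + _).
have NE := beta'_gamma' alpha beta gamma g alpha0.
have GE := gamma''_powR alpha gamma g alpha0 x1 x2; rewrite -/G in GE.
rewrite /stable_phase powR1 mul1r /delta_ave.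
have Gn0 : G `^ alpha != 0 by rewrite gt_eqF.
(* Clearing the denominator of [beta''] leaves the signed sums that the two inputs contribute. *)
have bE : beta'' alpha beta gamma g x1 x2 * G `^ alpha =
    \sum_m beta m * Num.sg (g m x1) * `|gamma m * g m x1| `^ alpha -
    \sum_m beta m * Num.sg (g m x2) * `|gamma m * g m x2| `^ alpha.
  have H b1 u1 b2 u2 v : v != 0 -> v = u1 + u2 ->
      (b1 * u1 - b2 * u2) / (u1 + u2) * v = b1 * u1 - b2 * u2 :> R.
    by move=> v0 vE; rewrite -vE divfK.
  by rewrite -(NE x1) -(NE x2); exact: H Gn0 GE.
have [a1|/eqP a1] := pselect (alpha = 1); last first.
  rewrite (negbTE a1) mulr0 mul0r addr0 /stable_skew a1.
  have E i : \sum_m (gamma m `^ alpha * `|t * ave_weight i m| `^ alpha *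
       (beta m * Num.sg (t * ave_weight i m) * tan (pi * alpha / 2))) =
     `|t| `^ alpha * Num.sg t * tan (pi * alpha / 2) / (K%:R * G `^ alpha) *
     (input_sign i * \sum_m beta m * Num.sg (g m (input_at i)) *
        `|gamma m * g m (input_at i)| `^ alpha).
    rewrite !mulr_sumr; apply: eq_bigr => m _.
    rewrite ave_weight_powR ave_weight_sg.
    move: (G `^ alpha) (`|t| `^ alpha) (tan _) (`|_| `^ _) Ga_gt0 => u v w z u0.
    by field; rewrite Kn0 gt_eqF.
  rewrite (sum_pair_fst _ _ (fun i =>
    \sum_m (gamma m `^ alpha * `|t * ave_weight i m| `^ alpha *
       (beta m * Num.sg (t * ave_weight i m) * tan (pi * alpha / 2))))) !E.
  rewrite /input_sign /input_at /= mul1r mulN1r -mulrDr -bE.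
  move: (G `^ alpha) (`|t| `^ alpha) (tan _) (beta'' _ _ _ _ _ _) Ga_gt0 => u v w z u0.
  by field; rewrite Kn0 gt_eqF.
have p1 (y : R) : 0 <= y -> y `^ alpha = y by move=> y0; rewrite a1 powRr1.
have a1b : (alpha == 1) = true by rewrite a1 eqxx.
have G0 : 0 < G := gamma''_gt0.
have Gneq : G != 0 by rewrite gt_eqF.
have pin0 : pi != 0 :> R by rewrite gt_eqF// pi_gt0.
have KG : 0 < K%:R * G by rewrite mulr_gt0// ltr0n.
have lE : ave_scale = K%:R * G by rewrite /ave_scale {1}a1 divr1 powRr1// ler0n.
(* At [alpha] = 1 the logarithm of the weighted frequency splits in three: ln |t| feeds the
   skewness, ln |g m| feeds [delta''], and - ln (K G), from the scale K G, feeds the logarithm in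
   [delta_ave]. *)
have skE i m :
  gamma m `^ alpha * `|t * ave_weight i m| `^ alpha *
     (beta m * Num.sg (t * ave_weight i m) * stable_skew alpha (t * ave_weight i m)) =
  - (2 / pi) * t / (K%:R * G) * input_sign i *
   ((ln `|t| - ln (K%:R * G)) *
      (beta m * Num.sg (g m (input_at i)) * `|gamma m * g m (input_at i)| `^ alpha) +
    beta m * gamma m * g m (input_at i) * ln `|g m (input_at i)|).
  rewrite /stable_skew a1b/= ave_weight_powR !p1 ?(ltW G0)//.
  (* The logarithm splits only for nonzero factors; if [t] or [g m] is 0, both sides vanish. *)
  have [->|/eqP t0] := pselect (t = 0); first by rewrite normr0 !(mul0r, mulr0).
  have [->|/eqP g0] := pselect (g m (input_at i) = 0).
    by rewrite mulr0 normr0 sgr0 !(mul0r, mulr0) addr0 mulr0.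
  rewrite ave_weight_sg.
  have -> : `|t * ave_weight i m| = `|t| * (`|g m (input_at i)| / (K%:R * G)).
    rewrite /ave_weight lE 3!normrM normfV (gtr0_norm KG).
    have -> : `|input_sign i| = 1 by rewrite /input_sign; case: eqP => _; rewrite ?normrN normr1.
    by rewrite mul1r.
  have -> : ln (`|t| * (`|g m (input_at i)| / (K%:R * G))) =
      ln `|t| + (ln `|g m (input_at i)| - ln (K%:R * G)).
    have t'0 : 0 < `|t| by rewrite normr_gt0.
    have g'0 : 0 < `|g m (input_at i)| by rewrite normr_gt0.
    by rewrite (lnM t'0 (divr_gt0 g'0 KG : _ \in Num.pos)) (ln_div g'0 KG).
  rewrite normrM (gtr0_norm (gamma0 m)).
  have E : beta m * gamma m * g m (input_at i) =
    beta m * Num.sg (g m (input_at i)) * (gamma m * `|g m (input_at i)|).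
    by rewrite {1}(numEsg (g m (input_at i))); ring.
  have -> : - (2 / pi) * t = - (2 / pi) * (Num.sg t * `|t|) by rewrite -numEsg.
  rewrite E.
  move: (ln `|t|) (ln `|g m (input_at i)|) (ln (K%:R * G)) => l1 l2 l3.
  move: `|t| `|g m (input_at i)| (Num.sg t) (Num.sg (g m (input_at i))) => t' g' st sg.
  by move: (pi : R) pin0 => p p0; field; rewrite ?Kn0 ?Gneq ?p0.
have E i : \sum_m (gamma m `^ alpha * `|t * ave_weight i m| `^ alpha *
     (beta m * Num.sg (t * ave_weight i m) * stable_skew alpha (t * ave_weight i m))) =
  - (2 / pi) * t / (K%:R * G) * input_sign i *
   ((ln `|t| - ln (K%:R * G)) *
      (\sum_m beta m * Num.sg (g m (input_at i)) * `|gamma m * g m (input_at i)| `^ alpha) +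
    \sum_m beta m * gamma m * g m (input_at i) * ln `|g m (input_at i)|).
  rewrite mulr_sumr -big_split mulr_sumr; apply: eq_bigr => m _; exact: skE.
rewrite (sum_pair_fst _ _ (fun i => \sum_m (gamma m `^ alpha *
  `|t * ave_weight i m| `^ alpha * (beta m * Num.sg (t * ave_weight i m) *
  stable_skew alpha (t * ave_weight i m))))) !E.
rewrite /input_sign /input_at /= /stable_skew a1b/= mulr1 /delta'' /delta' -/G.
rewrite (p1 _ (normr_ge0 t)).
rewrite (p1 G (ltW G0)) in bE.
(* [bE] eliminates the signed sum at [x1]; the one at [x2] then cancels. *)
have {bE} := esym bE; move/eqP; rewrite subr_eq => /eqP ->.
have -> : `|t| * (beta'' alpha beta gamma g x1 x2 * Num.sg t * (- (2 / pi) * ln `|t|)) =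
  t * (beta'' alpha beta gamma g x1 x2 * (- (2 / pi) * ln `|t|)).
  by rewrite [X in _ = X * _](numEsg t); ring.
move: (ln `|t|) (ln (K%:R * G)) => l1 l2.
move: (beta'' alpha beta gamma g x1 x2) => b.
by move: (pi : R) pin0 => p p0; field; rewrite ?Kn0 ?Gneq ?p0.
Qed.

End averaged_exponent.

(** * Transfer between equal laws, and decay of stable characteristic functions *)

Lemma char_fun_law {R : realType} {d d' d'' : measure_display}
    {T : measurableType d} {T' : measurableType d'} {U : measurableType d''}
    (P : probability T R) (P' : probability T' R)
    (X : {RV P >-> U}) (Y : {RV P' >-> U}) (w : U -> R) t :
  (forall A, measurable A -> distribution P X A = distribution P' Y A) ->
  measurable_fun setT w ->
  char_fun P (fun x => w (X x)) t = char_fun P' (fun y => w (Y y)) t.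
Proof.
move=> XY mw.
have E (f : U -> R) : bounded_measurable f ->
    \int[P]_x f (X x) = \int[P']_y f (Y y).
  move=> bf; have mf : measurable_fun setT (EFin \o f).
    by apply/measurable_EFinP; case: bf.
  have iX := bounded_measurable_integrable P _
    (bounded_measurable_comp f X bf (measurable_funPT X)).
  have iY := bounded_measurable_integrable P' _
    (bounded_measurable_comp f Y bf (measurable_funPT Y)).
  rewrite /Rintegral; congr fine.
  rewrite -(integral_distribution mf iX) -(integral_distribution mf iY).
  by apply: eq_measure_integral => A mA _; exact: XY.
rewrite /char_fun unlock.
have := E _ (bounded_measurable_comp _ _ (bounded_measurable_cos t) mw).
have := E _ (bounded_measurable_comp _ _ (bounded_measurable_sin t) mw).
by rewrite /Rintegral => -> ->.
Qed.

(** For s > 0 the characteristic function has modulus exp (- s^a), which tends to 0 because a >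
    0. *)
Lemma stable_cos_sin_cvg0 {R : realType} {d : measure_display}
    {T : measurableType d} (P : probability T R) (X : T -> R) (a b l : R) :
  0 < a -> has_stable_law P X a b 1 l ->
  \int[P]_x cos (s * X x) @[s --> +oo] --> (0 : R) /\
  \int[P]_x sin (s * X x) @[s --> +oo] --> (0 : R).
Proof.
move=> a0 XS.
have E s : 0 < s -> \int[P]_x cos (s * X x) = expR (- (s `^ a)) * cos (stable_phase a b 1 l s) /\
    \int[P]_x sin (s * X x) = expR (- (s `^ a)) * sin (stable_phase a b 1 l s).
  move=> s0; have := XS s; rewrite stable_char_funE// powR1 mul1r gtr0_norm//.
  rewrite /char_fun unlock => H; split.
    by have /= := congr1 (@complex.Re R) H; rewrite mul0r subr0.
  by have /= := congr1 (@complex.Im R) H; rewrite mul0r addr0.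
have dec : expR (- (s `^ a)) @[s --> +oo] --> (0 : R).
  apply: (@cvg_comp _ _ _ (fun s => s `^ a) (fun y => expR (- y)) _ +oo).
    apply/cvgryPge => A; near=> s.
    have s0 : 0 <= s by near: s; apply: nbhs_pinfty_ge; exact: num_real.
    have [A0|A0] := leP A 0; first by rewrite (le_trans A0)// powR_ge0.
    have -> : A = (A `^ a^-1) `^ a by rewrite -powRrM mulVf ?gt_eqF// powRr1// ltW.
    apply: (ge0_ler_powR (ltW a0)).
    - by rewrite nnegrE powR_ge0.
    - by rewrite nnegrE.
    - near: s; apply: nbhs_pinfty_ge; exact: num_real.
  exact: cvgr_expR.
have sq (F : R -> R) (u : R -> R) : (forall x, `|u x| <= 1) ->
    (forall s, 0 < s -> F s = expR (- (s `^ a)) * u s) -> F s @[s --> +oo] --> (0 : R).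
  move=> u1 FE.
  apply: (@squeeze_cvgr _ _ _ _ (fun s => - expR (- (s `^ a))) (fun s => expR (- (s `^ a)))) => //.
    near=> s; have s0 : 0 < s by near: s; apply: nbhs_pinfty_gt; exact: num_real.
    rewrite -ler_norml FE// normrM (ger0_norm (expR_ge0 _)).
    by rewrite ler_piMr ?expR_ge0.
  by have := cvgN dec; rewrite oppr0 => H; exact: H.
split.
  apply: (sq _ (fun s => cos (stable_phase a b 1 l s))) => [x|s /E[]//].
  by rewrite ler_norml cos_geN1 cos_le1.
apply: (sq _ (fun s => sin (stable_phase a b 1 l s))) => [x|s /E[]//].
by rewrite ler_norml sin_geN1 sin_le1.
Unshelve. all: by end_near. Qed.

(** * The law of the standardized averaged noise *)

Section averaged_noise.
Context {R : realType} {D M K : nat} (alpha : R) (beta gamma delta : 'I_M -> R)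
  (g : 'I_M -> 'rV[R]_D -> R) (x1 x2 : 'rV[R]_D).
Context {d0 d : measure_display} {T0 : measurableType d0} {T : measurableType d}
  (P0 : probability T0 R) (P : probability T R)
  (eps : {RV P0 >-> M.-tuple R}) (Eps : 'I_2 -> 'I_K -> {RV P >-> M.-tuple R}).
Hypotheses (K0 : (0 < K)%N) (alpha0 : 0 < alpha) (gamma0 : forall m, 0 < gamma m)
  (gamma''0 : gamma'' alpha gamma g x1 x2 != 0)
  (heps : forall m, has_stable_law P0 (fun w => tnth (eps w) m)
                      alpha (beta m) (gamma m) (delta m))
  (heps_indep : mutually_independent P0 (fun m w => tnth (eps w) m))
  (hEps_law : forall i k (A : set (M.-tuple R)), measurable A ->
     distribution P (Eps i k) A = distribution P0 eps A)
  (hEps_indep : mutually_independent P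
     (fun (ik : 'I_2 * 'I_K) w => Eps ik.1 ik.2 w)).

Let weight := ave_weight (K := K) alpha gamma g x1 x2.
Let scale := ave_scale (K := K) alpha gamma g x1 x2.

Definition noise_part (i : 'I_2) (e : M.-tuple R) : R :=
  \sum_m weight i m * tnth e m.

(** This is [K / scale] times the deviation of the averaged difference of [f] from its value at
    [Delta]; the terms in [h] cancel. *)
Definition standardized_noise (w : T) : R :=
  \sum_(ik : 'I_2 * 'I_K) noise_part ik.1 (Eps ik.1 ik.2 w)
  - K%:R / scale * (\sum_m g m x1 * delta m - \sum_m g m x2 * delta m).

Lemma measurable_noise_part i : measurable_fun setT (noise_part i).
Proof.
apply: measurable_sum => m; apply: measurable_funM; first exact: measurable_cst.
exact: measurable_tnth.
Qed.

Lemma measurable_noise_sum : measurable_fun setT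
  (fun w => \sum_(ik : 'I_2 * 'I_K) noise_part ik.1 (Eps ik.1 ik.2 w)).
Proof.
apply: measurable_sum => ik.
exact: measurableT_comp (measurable_noise_part _) (measurable_funPT _).
Qed.

Lemma measurable_standardized_noise : measurable_fun setT standardized_noise.
Proof.
apply: measurable_funB; [exact: measurable_noise_sum|exact: measurable_cst].
Qed.

(** The law of the copy is that of [eps], whose coordinates are independent and stable. *)
Lemma char_fun_noise_part i k t :
  char_fun P (fun w => noise_part i (Eps i k w)) t =
  \prod_m polar (- (gamma m `^ alpha * `|t * weight i m| `^ alpha))
    (stable_phase alpha (beta m) (gamma m) (delta m) (t * weight i m)).
Proof.
rewrite (char_fun_law _ _ _ _ _ t (hEps_law i k) (measurable_noise_part i)).
rewrite (char_fun_sum P0 (fun m w => tnth (eps w) m) (fun m y => weight i m * y)) //.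
- apply: eq_bigr => m _; rewrite -stable_char_funE ?ltW// -heps !char_funE.
  by apply: eq_cexpect => w; rewrite mulrA.
- move=> m; exact: measurableT_comp (measurable_tnth m) (measurable_funPT eps).
- by move=> m; apply: measurable_funM => //; exact: measurable_cst.
Qed.

(** Independence of the copies adds their polar exponents, summed by [ave_modulus] and [ave_phase];
    the centering removes the last summand of [ave_phase]. *)
Lemma standardized_noise_stable : has_stable_law P standardized_noise alpha
  (beta'' alpha beta gamma g x1 x2) 1 (delta_ave alpha beta gamma g K x1 x2).
Proof.
move=> t; rewrite stable_char_funE//.
transitivity (char_fun P (fun w => 1 *
    (\sum_(ik : 'I_2 * 'I_K) noise_part ik.1 (Eps ik.1 ik.2 w)) +
    - (K%:R / scale * (\sum_m g m x1 * delta m - \sum_m g m x2 * delta m))) t).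
  by rewrite !char_funE; apply: eq_cexpect => w; rewrite mul1r.
rewrite char_fun_affine; last exact: measurable_noise_sum.
rewrite mulr1.
have mEps (ik : 'I_2 * 'I_K) : measurable_fun setT (Eps ik.1 ik.2).
  exact: measurable_funPT.
rewrite (char_fun_sum P _ (fun (ik : 'I_2 * 'I_K) e => noise_part ik.1 e) t mEps
  hEps_indep (fun ik => measurable_noise_part ik.1)).
under eq_bigr do rewrite char_fun_noise_part -polar_sum.
rewrite -polar_sum (ave_modulus alpha gamma g x1 x2)// (ave_phase alpha beta gamma delta g x1 x2)//.
have -> x : cis x = polar 0 x by rewrite /polar expR0 mul1r.
by rewrite -polarD addr0 mulrN addrK.
Qed.

End averaged_noise.

(** * Probability that the averaged comparison has the correct sign *)

Theorem theorem3 (R : realType) (D M K : nat) (hK : (0 < K)%N)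
  (h : 'rV[R]_D -> R) (g : 'I_M -> 'rV[R]_D -> R)
  (f : 'rV[R]_D -> M.-tuple R -> R)
  (hf : forall x e, f x e = h x + \sum_(m < M) g m x * tnth e m)
  (alpha : R) (beta gamma delta : 'I_M -> R)
  (halpha : 0 < alpha <= 2)
  (hbeta : forall m, -1 <= beta m <= 1)
  (hgamma : forall m, 0 < gamma m)
  (* the noise vector *)
  (d0 : measure_display) (T0 : measurableType d0) (P0 : probability T0 R)
  (eps : {RV P0 >-> M.-tuple R})
  (heps : forall m, has_stable_law P0 (fun w => tnth (eps w) m)
                      alpha (beta m) (gamma m) (delta m))
  (heps_indep : mutually_independent P0 (fun m w => tnth (eps w) m))
  (* the i.i.d. copies of the noise vector *)
  (d : measure_display) (T : measurableType d) (P : probability T R)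
  (Eps : 'I_2 -> 'I_K -> {RV P >-> M.-tuple R})
  (hEps_law : forall i k (A : set (M.-tuple R)), measurable A ->
     distribution P (Eps i k) A = distribution P0 eps A)
  (hEps_indep : mutually_independent P
     (fun (ik : 'I_2 * 'I_K) w => Eps ik.1 ik.2 w))
  (x1 x2 : 'rV[R]_D)
  (hgamma'' : gamma'' alpha gamma g x1 x2 != 0) :
  let Delta := [tuple delta m | m < M] in
  let eta := eta_true f Delta x1 x2 in
  let Pr_correct := P [set w | eta_ave f (fun k => Eps ord0 k w)
                                 (fun k => Eps ord_max k w) x1 x2 = eta] in
  (eta != 0 ->
   forall (d1 : measure_display) (T1 : measurableType d1)
     (P1 : probability T1 R) (eAVE : {RV P1 >-> R}),
   has_stable_law P1 eAVE alpha (beta'' alpha beta gamma g x1 x2) 1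
     (delta_ave alpha beta gamma g K x1 x2) ->
   Pr_correct =
   P1 [set w | - eta * eAVE w <
               K%:R `^ (1 - 1 / alpha) * `|f x1 Delta - f x2 Delta|
               / gamma'' alpha gamma g x1 x2]) /\
  (eta = 0 -> Pr_correct = 0%E).
Proof.
have /andP[alpha0 _] := halpha.
move=> Delta eta Pr.
set lam := ave_scale (K := K) alpha gamma g x1 x2.
have lam0 : 0 < lam by exact: ave_scale_gt0.
have K0 : 0 < K%:R :> R by rewrite ltr0n.
have kap0 : 0 < lam / K%:R by rewrite divr_gt0.
pose Y := standardized_noise alpha gamma delta g x1 x2 P Eps.
have mY : measurable_fun setT Y by exact: measurable_standardized_noise.
have YS : has_stable_law P Y alpha (beta'' alpha beta gamma g x1 x2) 1
    (delta_ave alpha beta gamma g K x1 x2).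
  exact: standardized_noise_stable heps heps_indep hEps_law hEps_indep.
set df := f x1 Delta - f x2 Delta.
(* The averaged difference is the noise-free difference [df] plus a positive multiple of [Y]. *)
have avgE w : 1 / K%:R * (\sum_(k < K) f x1 (Eps ord0 k w)) -
    1 / K%:R * (\sum_(k < K) f x2 (Eps ord_max k w)) = lam / K%:R * Y w + df.
  rewrite /Y /standardized_noise (sum_pair2 _ _ (fun i k =>
    noise_part alpha gamma g x1 x2 i (Eps i k w))).
  have nE i e : noise_part (K := K) alpha gamma g x1 x2 i e =
      input_sign i / lam * (f (input_at x1 x2 i) e - h (input_at x1 x2 i)).
    rewrite hf addrAC subrr add0r mulr_sumr; apply: eq_bigr => m _.
    by rewrite /ave_weight -/lam; ring.
  have sE i : \sum_k noise_part (K := K) alpha gamma g x1 x2 i (Eps i k w) =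
      input_sign i / lam * (\sum_k f (input_at x1 x2 i) (Eps i k w) - K%:R * h (input_at x1 x2 i)).
    under eq_bigr do rewrite nE.
    by rewrite -mulr_sumr sumrB sumr_const card_ord mulr_natl.
  rewrite !sE /input_sign /input_at /= -/lam.
  have DE x : \sum_m g m x * delta m = f x Delta - h x.
    rewrite hf addrAC subrr add0r; apply: eq_bigr => m _.
    by rewrite tnth_mktuple.
  rewrite !DE /df.
  move: (\sum_k _) (\sum_k _) (f x1 _) (f x2 _) lam0 => s1 s2 f1 f2.
  move: (lam) => l l0.
  by field; rewrite !gt_eqF.
split; last first.
  rewrite /eta /eta_true -/df => /eqP; rewrite sgr_eq0 => /eqP df0.
  (* When [df] is 0, the estimated sign is 0 exactly on the event [Y = 0]. *)
  rewrite -(char_fun_no_atom P Y mY); last 2 first.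
  - by have [] := stable_cos_sin_cvg0 _ _ _ _ _ alpha0 YS.
  - by have [] := stable_cos_sin_cvg0 _ _ _ _ _ alpha0 YS.
  rewrite /Pr; congr (P _); apply/seteqP; split => w /=; rewrite /eta_ave avgE df0 addr0.
    rewrite /eta /eta_true -/df df0 sgr0 => /eqP; rewrite sgr_eq0 mulf_eq0.
    by rewrite (gt_eqF kap0) => /eqP.
  by move=> ->; rewrite mulr0 /eta /eta_true -/df df0.
move=> eta0 d1 T1 P1 eAVE eS.
have df0 : df != 0 by move: eta0; rewrite /eta /eta_true sgr_eq0.
have mE := measurable_funPT eAVE.
(* The power of [K] is K divided by the factor K^(1/alpha) contained in [lam]. *)
have thrE : K%:R `^ (1 - 1 / alpha) * `|df| / gamma'' alpha gamma g x1 x2 =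
    `|df| / (lam / K%:R).
  rewrite powRD; last by rewrite (lt0r_neq0 K0) implybT.
  rewrite powRr1 ?ltW// powRN /lam /ave_scale.
  have p0 : 0 < K%:R `^ (1 / alpha) :> R by rewrite powR_gt0.
  move: (gamma'' _ _ _ _ _) hgamma'' (K%:R `^ (1 / alpha)) p0 => G G0 p p0.
  by move: K0 => /lt0r_neq0; move: (K%:R : R) => k k0; field; rewrite k0 G0 gt_eqF.
rewrite thrE.
(* [Y] and [eAVE] share their characteristic function, hence so do their multiples by [- eta]. *)
rewrite -(char_fun_lt P P1 (fun w => - eta * Y w)); first last.
- move=> t; rewrite !char_funE.
  rewrite (@eq_cexpect _ _ _ P _ (fun w => cis (t * - eta * Y w))); last first.
    by move=> w; rewrite mulrA.
  rewrite (@eq_cexpect _ _ _ P1 _ (fun w => cis (t * - eta * eAVE w))); last first.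
    by move=> w; rewrite mulrA.
  by rewrite -!char_funE YS eS.
- by apply: measurable_funM => //; exact: measurable_cst.
- by apply: measurable_funM => //; exact: measurable_cst.
rewrite /Pr; congr (P _); apply/seteqP.
(* The sign is that of [df] unless the noise opposes it with at least its size. A tie has sign 0,
   which differs from [eta], so the inequality is strict. *)
have eqv w : (Num.sg (lam / K%:R * Y w + df) = eta) <-> (- eta * Y w < `|df| / (lam / K%:R)).
  rewrite ltr_pdivlMr// /eta /eta_true -/df.
  have [dn|dp|/eqP] := ltgtP df 0; last by rewrite (negbTE df0).
    rewrite (ltr0_sg dn) (ltr0_norm dn) opprK mul1r; split.
      by move=> /eqP; rewrite sgr_cp0 => H; rewrite ltrNr; lra.
    by move=> H; apply/eqP; rewrite sgr_cp0; lra.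
  rewrite (gtr0_sg dp) (gtr0_norm dp) mulN1r; split.
    by move=> /eqP; rewrite sgr_cp0 => H; lra.
  by move=> H; apply/eqP; rewrite sgr_cp0; lra.
by split => w /=; rewrite /eta_ave avgE => /eqv.
Qed.
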